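(* Let $n$ be a non-negative integer and $s$ any integer. Then \[ \sum_{j = 0}^n \frac{F_{j + n + s}}{\binom nj} = (n + 1)\sum_{j = 0}^n \frac{F_{j + s - 2} + F_{2j + s - 1}}{j + 1}, \qquad \sum_{j = 0}^n \frac{L_{j + n + s}}{\binom nj} = (n + 1)\sum_{j = 0}^n \frac{L_{j + s - 2} + L_{2j + s - 1}}{j + 1}. \]
   Context: $F_j$ and $L_j$ denote the Fibonacci and Lucas numbers, defined for all integers $j$ by $F_0=0$, $F_1=1$, $L_0=2$, $L_1=1$, $F_j=F_{j-1}+F_{j-2}$, $L_j=L_{j-1}+L_{j-2}$, extended to negative indices by $F_{-j}=(-1)^{j-1}F_j$, $L_{-j}=(-1)^jL_j$; equivalently $F_j=(\alpha^j-\beta^j)/(\alpha-\beta)$, $L_j=\alpha^j+\beta^j$ with $\alpha=(1+\sqrt5)/2$, $\beta=(1-\sqrt5)/2$. For non-negative integers $i,j$, $\binom ij=\frac{i!}{j!(i-j)!}$ if $i\ge j$. *)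

(* Defs.v *)
From mathcomp Require Import all_boot all_order all_algebra.

Set Implicit Arguments.
Unset Strict Implicit.
Unset Printing Implicit Defensive.

Import Order.TTheory GRing.Theory Num.Theory.

Local Open Scope ring_scope.

Fixpoint fibn (n : nat) : nat :=
  if n is n1.+1 then (if n1 is n2.+1 then fibn n1 + fibn n2 else 1)%N else 0%N.

Fixpoint lucn (n : nat) : nat :=
  if n is n1.+1 then (if n1 is n2.+1 then lucn n1 + lucn n2 else 1)%N else 2%N.

(* [Negz n] is the integer -(n+1), so F_{-j} = (-1)^(j-1) F_j and
   L_{-j} = (-1)^j L_j are read here with j = n+1. *)
Definition fib (j : int) : int :=
  match j with
  | Posz n => (fibn n)%:Z
  | Negz n => (-1) ^+ n * (fibn n.+1)%:Z
  end.

Definition luc (j : int) : int :=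
  match j with
  | Posz n => (lucn n)%:Z
  | Negz n => (-1) ^+ n.+1 * (lucn n.+1)%:Z
  end.

Lemma fibnSS (n : nat) : fibn n.+2 = (fibn n.+1 + fibn n)%N.
Proof. by []. Qed.

Lemma lucnSS (n : nat) : lucn n.+2 = (lucn n.+1 + lucn n)%N.
Proof. by []. Qed.

Lemma fib_rec (j : int) : fib j = fib (j - 1) + fib (j - 2).
Proof.
case: j => [[|[|n]]|n] //.
- have -> : n.+2%:Z - 1 = n.+1%:Z by rewrite -[n.+2]addn1 PoszD addrK.
  have -> : n.+2%:Z - 2 = n%:Z by rewrite -[n.+2]addn2 PoszD addrK.
  by rewrite /fib fibnSS PoszD.
- have -> : Negz n - 1 = Negz n.+1 by rewrite !NegzE -opprD -PoszD addn1.
  have -> : Negz n - 2 = Negz n.+2 by rewrite !NegzE -opprD -PoszD addn2.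
  rewrite /fib [fibn n.+3]fibnSS PoszD !exprS !mulN1r opprK mulNr mulrDr.
  by rewrite addKr.
Qed.

Lemma luc_rec (j : int) : luc j = luc (j - 1) + luc (j - 2).
Proof.
case: j => [[|[|n]]|n] //.
- have -> : n.+2%:Z - 1 = n.+1%:Z by rewrite -[n.+2]addn1 PoszD addrK.
  have -> : n.+2%:Z - 2 = n%:Z by rewrite -[n.+2]addn2 PoszD addrK.
  by rewrite /luc lucnSS PoszD.
- have -> : Negz n - 1 = Negz n.+1 by rewrite !NegzE -opprD -PoszD addn1.
  have -> : Negz n - 2 = Negz n.+2 by rewrite !NegzE -opprD -PoszD addn2.
  rewrite /luc [lucn n.+3]lucnSS PoszD !exprS !mulN1r !opprK !mulNr mulrDr.
  by rewrite opprD addNKr.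
Qed.

(* Main.v *)
Require Import Defs.
From mathcomp Require Import all_boot all_order all_algebra.
From mathcomp Require Import ring.

Import Order.TTheory GRing.Theory Num.Theory.

Local Open Scope ring_scope.

(** Let A_n be the left-hand side for a sequence G with G_j = G_{j-1} + G_{j-2}.
    Split every term of A_{n+1} by the recurrence; peeling off the last term of
    one half and the first term of the other, the remaining terms pair up
    through 1/C(n+1,j) + 1/C(n+1,j+1) = (n+2)/(n+1) * 1/C(n,j).  Hence
    A_{n+1}/(n+2) = A_n/(n+1) + (G_{n+s-1} + G_{2n+s+1})/(n+2), and the result
    follows by telescoping. *)

Lemma inv_binD (R : numFieldType) (n j : nat) : (j <= n)%N ->
  ('C(n.+1, j)%:R)^-1 + ('C(n.+1, j.+1)%:R)^-1
  = n.+2%:R / n.+1%:R / 'C(n, j)%:R :> R.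
Proof.
move=> le_jn.
have invE (x y a b : R) : b != 0 -> a * x = b * y -> y^-1 = b / (a * x).
  by move=> b0 ->; rewrite invfM mulVKf.
(* Both reciprocals get the denominator [(n+1) * 'C(n, j)], with numerators [n+1-j] and [j+1], which
   add up to [n+2]. *)
have := mul_bin_diag n.+1 j; have := mul_bin_down n.+1 j.
move=> /(congr1 (fun k => k%:R : R)) /=; rewrite subSn // !natrM => /invE->.
  move=> /(congr1 (fun k => k%:R : R)); rewrite !natrM => /invE->.
    by rewrite -mulrDl -natrD addSn addnS subnK // invfM mulrA.
  by rewrite pnatr_eq0.
by rewrite pnatr_eq0.
Qed.

Lemma sum_recurrent_inv_bin (R : numFieldType) (G : int -> R) (n : nat) (s : int) :
    (forall j, G j = G (j - 1) + G (j - 2)) ->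
  \sum_(0 <= j < n.+1) G (j%:Z + n%:Z + s) / 'C(n, j)%:R
  = n.+1%:R * \sum_(0 <= j < n.+1)
      (G (j%:Z + s - 2) + G (2 * j%:Z + s - 1)) / j.+1%:R.
Proof.
move=> Grec; elim: n => [|n IHn].
  by rewrite !big_nat1 bin0 !divr1 mul1r !add0r addrC; apply: Grec.
have nz k : k.+1%:R != 0 :> R by rewrite pnatr_eq0.
(* The new term [j = n+1] has denominator [n+2], which cancels the outer factor. *)
rewrite [in RHS]big_nat_recr //= mulrDr [n.+2%:R * (_ / _)]mulrC divfK //.
have -> : n.+2%:R * \sum_(0 <= j < n.+1)
      (G (j%:Z + s - 2) + G (2 * j%:Z + s - 1)) / j.+1%:R
    = \sum_(0 <= j < n.+1) G (j%:Z + n%:Z + s) *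
        (n.+2%:R / n.+1%:R / 'C(n, j)%:R).
  under [RHS]eq_bigr => j _ do rewrite mulrCA.
  by rewrite -mulr_sumr IHn mulrA divfK.
have -> : \sum_(0 <= j < n.+2) G (j%:Z + n.+1%:Z + s) / 'C(n.+1, j)%:R
    = \sum_(0 <= j < n.+2) G (j%:Z + n%:Z + s) / 'C(n.+1, j)%:R
    + \sum_(0 <= j < n.+2) G (j%:Z + n%:Z + s - 1) / 'C(n.+1, j)%:R.
  rewrite -big_split; apply: eq_bigr => j _ /=; rewrite -mulrDl Grec.
  by congr ((G _ + G _) / _); rewrite -addn1 PoszD; ring.
(* The peeled terms [G (2n+1+s)] and [G (n+s-1)] have coefficient 1 and match the new term on the
   right. Shifting the index of the second half by one gives both halves the values [G (j+n+s)]. *)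
rewrite big_nat_recr //= [X in _ + X]big_nat_recl //= bin0 binn !divr1.
under [in RHS]eq_big_nat => j /andP[_ le_jn] do
  rewrite -(inv_binD R n j le_jn) mulrDr.
rewrite big_split /= -!addrA; congr (_ + _).
rewrite [LHS]addrC [X in X + _ = _]addrC -[LHS]addrA; congr (_ + (G _ + G _)).
- by apply: eq_bigr => j _; congr (G _ / _); rewrite -addn1 PoszD; ring.
- by rewrite -addn1 PoszD; ring.
- by rewrite -addn1 PoszD; ring.
Qed.

Theorem theorem1 (n : nat) (s : int) :
  (\sum_(0 <= j < n.+1) (fib (j%:Z + n%:Z + s))%:Q / 'C(n, j)%:R
   = n.+1%:R * \sum_(0 <= j < n.+1)
       ((fib (j%:Z + s - 2))%:Q + (fib (2 * j%:Z + s - 1))%:Q) / j.+1%:R)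
  /\
  (\sum_(0 <= j < n.+1) (luc (j%:Z + n%:Z + s))%:Q / 'C(n, j)%:R
   = n.+1%:R * \sum_(0 <= j < n.+1)
       ((luc (j%:Z + s - 2))%:Q + (luc (2 * j%:Z + s - 1))%:Q) / j.+1%:R).
Proof.
split.
(* The cast to the rationals is additive, so it preserves the recurrence. *)
- apply: (sum_recurrent_inv_bin _ (fun j => (fib j)%:Q)) => j.
  by rewrite -intrD -fib_rec.
- apply: (sum_recurrent_inv_bin _ (fun j => (luc j)%:Q)) => j.
  by rewrite -intrD -luc_rec.
Qed.
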